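(* Let $1\le j\le d$ and $p>0$, let $\mathbb S_n=(S_n,\sigma_n,v_n)$, $n=1,\dots,j$, be generalised $d$-hypersurfaces, and let $\{(A_i,\alpha_i)\}_{i=1}^m$ be a uniform cover of $\{1,\dots,j\}$ with $k_i=|A_i|$. For $x=(x_1,\dots,x_j)\in\prod_{n=1}^jS_n$ let $\hat v_n(x_n)=v_n(x_n)/|v_n(x_n)|$ if $v_n(x_n)\ne0$ and $\hat v_n(x_n)=\tilde u_n$ if $v_n(x_n)=0$, where each $\tilde u_n$ is an arbitrary fixed unit vector. Let $C(x)=(\langle \hat v_a(x_a),\hat v_b(x_b)\rangle)_{a,b=1}^j$, let $C_{A_i}(x)$ be the principal submatrix of $C(x)$ with indices in $A_i$, and define $$\rho(x)=\frac{(\det C(x))^{1/2}}{\prod_{i=1}^m(\det C_{A_i}(x))^{\alpha_i/2}}.$$ Then $$Q_j^p(\mathbb S_1,\dots,\mathbb S_j)\le \Big(\sup_{x\in\prod_nS_n}\rho(x)^{1/j}\Big)\prod_{i=1}^m Q_{k_i}^p\big((\mathbb S_n)_{n\in A_i}\big)^{\alpha_ik_i/j},$$ where $$\sup_x\rho(x)=\sup_{(u_1,\dots,u_j)\in\mathcal V_1\times\cdots\times\mathcal V_j}\frac{\big(\det(\langle u_a,u_b\rangle)_{a,b=1}^j\big)^{1/2}}{\prod_{i=1}^m\big(\det(\langle u_a,u_b\rangle)_{a,b\in A_i}\big)^{\alpha_i/2}},\qquad \mathcal V_n=\{\hat v_n(x_n):x_n\in S_n\}.$$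
   Context: A generalised $d$-hypersurface is a triple $\mathbb S=(S,\sigma,v)$ where $(S,\sigma)$ is a $\sigma$-finite measure space and $v:S\to\mathbb R^d$ is measurable. For $p>0$ and generalised $d$-hypersurfaces $\mathbb S_1,\dots,\mathbb S_k$ with $k\le d$, $$Q_k^p(\mathbb S_1,\dots,\mathbb S_k)=\Big(\int_{S_k}\cdots\int_{S_1}|v_1(x_1)\wedge\cdots\wedge v_k(x_k)|^p\,d\sigma_1(x_1)\cdots d\sigma_k(x_k)\Big)^{1/(kp)},$$ where $|v_1\wedge\cdots\wedge v_k|$ is the $k$-dimensional volume of the parallelotope spanned by $v_1,\dots,v_k$. A uniform cover $\{(A_i,\alpha_i)\}_{i=1}^m$ of $\{1,\dots,j\}$ consists of (non-empty) sets $A_i\subseteq\{1,\dots,j\}$ and numbers $\alpha_i>0$ with $\sum_{i=1}^m\alpha_i\chi_{A_i}(l)=1$ for every $1\le l\le j$. Conventions: $\rho(x)=0$ if some $\det C_{A_i}(x)=0$ (in which case $\det C(x)=0$ as well), and $0\cdot\infty=0$. *)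

(* Defs.v *)
From HB Require Import structures.
From mathcomp Require Import all_boot all_order all_algebra all_fingroup.
From mathcomp Require Import all_classical all_reals all_analysis.

Set Implicit Arguments.
Unset Strict Implicit.
Unset Printing Implicit Defensive.

Import Order.TTheory GRing.Theory Num.Theory.

Local Open Scope ring_scope.

(** Euclidean structure of R^d.  The library norm [`|v|] on ['rV[R]_d] is the
    sup norm, hence the explicit definitions. *)

Definition dotv (R : realType) (d : nat) (u v : 'rV[R]_d) : R :=
  \sum_(i < d) u 0 i * v 0 i.

Definition normv (R : realType) (d : nat) (v : 'rV[R]_d) : R :=
  Num.sqrt (dotv v v).

Definition gram (R : realType) (d k : nat) (u : 'I_k -> 'rV[R]_d) : 'M[R]_k :=
  \matrix_(a < k, b < k) dotv (u a) (u b).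

(** [|v_1 /\ ... /\ v_k|] for the rows [v_1, ..., v_k] of [M]: the coordinates
    of [v_1 /\ ... /\ v_k] in the orthonormal basis
    [e_(f 0) /\ ... /\ e_(f (k-1))], [f] strictly increasing, of the k-th
    exterior power of R^d are the maximal minors of [M], and the norm is the
    Euclidean one.  This is the k-dimensional volume of the parallelotope
    spanned by the rows; see [wedge_norm_gram]. *)

Definition increasing (k d : nat) (f : {ffun 'I_k -> 'I_d}) : bool :=
  [forall a : 'I_k, forall b : 'I_k, (a < b)%N ==> (f a < f b)%N].

Definition wedge_norm (R : realType) (k d : nat) (M : 'M[R]_(k, d)) : R :=
  Num.sqrt (\sum_(f : {ffun 'I_k -> 'I_d} | increasing f)
              \det (colsub f M) ^+ 2).

Section CauchyBinet.
Variables (R : realType) (k d : nat).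
Implicit Types (M : 'M[R]_(k, d)) (f g : {ffun 'I_k -> 'I_d}).

Lemma increasing_inj f : increasing f -> injective f.
Proof.
move=> /forallP incf a b fab; apply/val_inj/eqP => /=.
case: (ltngtP a b) => // h; first by
  have := implyP (forallP (incf a) b) h; rewrite fab ltnn.
by have := implyP (forallP (incf b) a) h; rewrite fab ltnn.
Qed.

Lemma increasing_eq f g : increasing f -> increasing g ->
  f @: 'I_k = g @: 'I_k -> f = g.
Proof.
have srt h : increasing h ->
    sorted (fun x y : 'I_d => (x < y)%N) (map h (enum 'I_k)).
  move=> /forallP inch; rewrite sorted_map.
  have : sorted (fun x y : 'I_k => (x < y)%N) (enum 'I_k).
    by have := iota_ltn_sorted 0 k; rewrite -val_enum_ord sorted_map.
  apply: sub_sorted => a b /= ab.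
  exact: implyP (forallP (inch a) b) ab.
move=> incf incg fg; apply/ffunP => a.
have : map f (enum 'I_k) = map g (enum 'I_k).
  apply: (irr_sorted_eq (leT := fun x y : 'I_d => (x < y)%N)).
  - by move=> x y z; apply: ltn_trans.
  - by move=> x; rewrite /= ltnn.
  - exact: srt.
  - exact: srt.
  - have mapE h x : (x \in map h (enum 'I_k)) = (x \in h @: 'I_k).
      apply/mapP/imsetP => -[i _ ->]; exists i => //.
      by rewrite mem_enum.
    by move=> x; rewrite !mapE fg.
by move/eq_in_map; apply; rewrite mem_enum.
Qed.

Lemma increasing_exists f : injective f ->
  exists2 g, increasing g & g @: 'I_k = f @: 'I_k.
Proof.
move=> injf; set I := f @: 'I_k.
have cI : #|I| = k by rewrite card_imset // card_ord.
pose g := [ffun a : 'I_k => enum_val (cast_ord (esym cI) a) : 'I_d].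
have srt : sorted (fun x y : 'I_d => (x < y)%N) (enum I).
  have -> : enum I = [seq x <- enum 'I_d | x \in I] by rewrite [in RHS]enumT.
  apply: sorted_filter; first by move=> x y z; apply: ltn_trans.
  by have := iota_ltn_sorted 0 d; rewrite -val_enum_ord sorted_map.
exists g.
  apply/forallP => a; apply/forallP => b; apply/implyP => ab.
  have x0 := f a.
  rewrite !ffunE !(enum_val_nth x0) /=.
  apply: (sorted_ltn_nth (leT := fun x y : 'I_d => (x < y)%N)) => //.
  - by move=> x y z; apply: ltn_trans.
  - by rewrite inE -cardE cI ltn_ord.
  - by rewrite inE -cardE cI ltn_ord.
apply/eqP; rewrite eqEcard; apply/andP; split.
  by apply/fintype.subsetP => _ /imsetP[a _ ->]; rewrite ffunE enum_valP.
rewrite cI card_imset ?card_ord // => a b.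
by rewrite !ffunE => /enum_val_inj/cast_ord_inj.
Qed.

Lemma wedge_norm_gram M :
  wedge_norm M = Num.sqrt (\det (gram (fun a => row a M))).
Proof.
rewrite /wedge_norm; congr Num.sqrt.
pose F f := (\prod_i M i (f i)) * \det (colsub f M).
transitivity (\sum_f F f); last first.
  rewrite /determinant; under [RHS]eq_bigr => s _.
    under eq_bigr => i _ do rewrite mxE.
    rewrite bigA_distr_bigA big_distrr /=; over.
  rewrite exchange_big /=; apply: eq_bigr => f _.
  rewrite /F -det_tr big_distrr /=; apply: eq_bigr => s _.
  rewrite mulrCA -big_split /=; congr (_ * _); apply: eq_bigr => i _.
  by rewrite !mxE.
rewrite [RHS](bigID (fun f => injectiveb f)) /=.
rewrite [X in _ = _ + X]big1 ?addr0; last first.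
  move=> f /injectivePn[a [b ab fab]]; rewrite /F -det_tr.
  rewrite (determinant_alternate ab) ?mulr0 // => i.
  by rewrite !mxE fab.
transitivity (\sum_(f : {ffun 'I_k -> 'I_d} | injectiveb f)
   \sum_(g | increasing g && (g @: 'I_k == f @: 'I_k)) F f); last first.
  apply: eq_bigr => f /injectiveP injf.
  have [g incg gf] := increasing_exists injf.
  rewrite (big_pred1 g) // => h /=; apply/andP/eqP => [[inch /eqP hf]|->].
    by apply: increasing_eq => //; rewrite hf gf.
  by rewrite incg gf.
rewrite (exchange_big_dep (fun g => increasing g)) /=; last by move=> f g _ /andP[].
apply: eq_bigr => g incg; have injg := increasing_inj incg.
under [RHS]eq_bigl => f do rewrite incg /=.
transitivity (\sum_(s : 'S_k) F [ffun i => g (s i)]).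
  rewrite expr2 {1}/determinant big_distrl /=; apply: eq_bigr => s _.
  have -> : F [ffun i => g (s i)] = (\prod_i M i (g (s i))) *
      (\det (colsub g M) * (-1) ^+ s).
    rewrite /F; congr (_ * _); first by apply: eq_bigr => i _; rewrite ffunE.
    rewrite -[in (-1) ^+ s]odd_permV -det_perm -det_mulmx -col_permE.
    by congr (\det _); apply/matrixP => a b; rewrite !mxE ffunE.
  rewrite mulrAC -mulrA mulrC -mulrA mulrCA mulrA -mulrA; congr (_ * _).
  by apply: eq_bigr => i _; rewrite !mxE.
rewrite [RHS](reindex (fun s : 'S_k => [ffun i => g (s i)])) /=.
  apply: eq_bigl => s; apply/esym/andP; split.
    by apply/injectiveP => a b; rewrite !ffunE => /injg/perm_inj.
  apply/eqP/setP => x; apply/imsetP/imsetP => -[a _ ->].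
    by exists (s^-1%g a); rewrite // ffunE permKV.
  by exists (s a); rewrite // ffunE.
case: (pickP (fun a : 'I_k => true)) => [a0 _|k0]; last first.
  exists (fun=> 1%g) => [s _|f _]; first by apply/permP => a; have := k0 a.
  by apply/ffunP => a; have := k0 a.
pose h f := finfun (fun a => odflt a0 [pick b | g b == f a]).
pose pr f : 'S_k := if injectiveP (h f) is ReflectT hi then perm hi else 1%g.
exists pr.
  move=> s _; have hE : h [ffun i => g (s i)] =1 s.
    move=> a; rewrite !ffunE; case: pickP => [b /eqP|/(_ (s a))].
      by move=> /injg.
    by rewrite eqxx.
  rewrite /pr; case: injectiveP => [hi|[]].
    by apply/permP => a; rewrite permE hE.
  by move=> a b; rewrite !hE => /perm_inj.
move=> f /andP[/injectiveP injf /eqP gf].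
have hE a : g (h f a) = f a.
  rewrite ffunE; case: pickP => [b /eqP //|no].
  have : f a \in g @: 'I_k by rewrite gf imset_f.
  by case/imsetP => b _ fb; have := no b; rewrite fb eqxx.
apply/ffunP => a; rewrite ffunE /pr; case: injectiveP => [hi|[]].
  by rewrite permE hE.
by move=> b c e; apply: injf; rewrite -!hE e.
Qed.

End CauchyBinet.

(** Generalised d-hypersurfaces.  Measurability of the R^d-valued map is stated
    coordinatewise, the Borel sigma-algebra of R^d being the product one. *)

Record hypersurface (R : realType) (d : nat) := Hypersurface {
  hs_display : measure_display ;
  hs_carrier :> measurableType hs_display ;
  hs_measure : {sigma_finite_measure set hs_carrier -> \bar R} ;
  hs_vec : hs_carrier -> 'rV[R]_d ;
  hs_vec_measurable :
    forall i : 'I_d, measurable_fun [set: hs_carrier] (fun x => hs_vec x 0 i)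
}.

(** [iterated_integral S F] integrates [F] applied to the matrix with rows
    [v_1 x_1, ..., v_k x_k], the innermost integral being over the first
    hypersurface. *)
Fixpoint iterated_integral (R : realType) (d k : nat) :
    ('I_k -> hypersurface R d) -> ('M[R]_(k, d) -> \bar R) -> \bar R :=
  match k with
  | 0 => fun _ F => F 0
  | k'.+1 => fun S F =>
      iterated_integral (fun n : 'I_k' => S (lift ord0 n))
        (fun M : 'M[R]_(k', d) =>
           (\int[hs_measure (S ord0)]_(x in [set: S ord0])
              F (col_mx (hs_vec x) M : 'M[R]_(k'.+1, d)))%E)
  end.

Definition Q (R : realType) (d k : nat) (p : R)
    (S : 'I_k -> hypersurface R d) : \bar R :=
  (iterated_integral S (fun M => (wedge_norm M `^ p)%:E) `^ (k%:R * p)^-1)%E.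

Definition subfamily (T : Type) (j : nat) (A : {set 'I_j}) (S : 'I_j -> T) :
    'I_#|A| -> T :=
  fun a => S (enum_val a).
Arguments subfamily {T j} A S _.

Definition uniform_cover (R : realType) (j m : nat) (A : 'I_m -> {set 'I_j})
    (alpha : 'I_m -> R) : Prop :=
  [/\ forall i, A i != finset.set0,
      forall i, 0 < alpha i &
      forall l : 'I_j, \sum_(i < m) alpha i * (l \in A i)%:R = 1].

Definition principal_submx (R : realType) (j : nat) (A : {set 'I_j})
    (C : 'M[R]_j) : 'M[R]_#|A| :=
  \matrix_(a < #|A|, b < #|A|) C (enum_val a) (enum_val b).

Definition det_ratio (R : realType) (j m : nat) (A : 'I_m -> {set 'I_j})
    (alpha : 'I_m -> R) (C : 'M[R]_j) : R :=
  if [exists i, \det (principal_submx (A i) C) == 0] then 0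
  else Num.sqrt (\det C)
       / \prod_(i < m) \det (principal_submx (A i) C) `^ (alpha i / 2).

Definition vhat (R : realType) (d : nat) (S : hypersurface R d)
    (u : 'rV[R]_d) (x : S) : 'rV[R]_d :=
  if hs_vec x == 0 then u else (normv (hs_vec x))^-1 *: hs_vec x.

Definition rho (R : realType) (d j m : nat) (S : 'I_j -> hypersurface R d)
    (u : 'I_j -> 'rV[R]_d) (A : 'I_m -> {set 'I_j}) (alpha : 'I_m -> R)
    (x : forall n : 'I_j, S n) : R :=
  det_ratio A alpha (gram (fun n => vhat (u n) (x n))).

(* Main.v *)
Require Import Defs.
From mathcomp Require Import all_boot all_order all_algebra.
From mathcomp Require Import all_classical all_reals all_analysis.
From mathcomp Require Import measurable_realfun ring.

(** Writing [v_n = |v_n| vhat_n], both sides of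
    [|v_1 /\ ... /\ v_j| = rho * \prod_i |/\_(n in A_i) v_n| ^ alpha_i]
    carry the same power of each [|v_n|] by uniformity of the cover, and the
    remaining factors are square roots of Gram determinants.  Raised to the
    power [p] and integrated, the product is bounded by Finner's inequality,
    which follows by integrating out one variable at a time: for each variable,
    the exponents of the functions depending on it add up to 1, so Hölder's
    inequality for several functions applies. *)

Import Order.TTheory GRing.Theory Num.Theory.

Local Open Scope ring_scope.
Local Open Scope classical_set_scope.

Set Implicit Arguments.
Unset Strict Implicit.
Unset Printing Implicit Defensive.

(** * Gram determinants and linear independence *)

Lemma dotv_mul (R : realType) d (u v : 'rV[R]_d) : dotv u v = (u *m v^T) 0 0.
Proof. by rewrite mxE; apply: eq_bigr => i _; rewrite mxE. Qed.

Lemma dotvv_eq0 (R : realType) d (v : 'rV[R]_d) : (dotv v v == 0) = (v == 0).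
Proof.
apply/eqP/eqP => [/eqP|->]; last by rewrite dotv_mul mul0mx mxE.
rewrite psumr_eq0 => [/allP v0|i _]; last by rewrite -expr2 sqr_ge0.
apply/rowP => i; rewrite mxE; have := v0 i; rewrite mem_index_enum => /(_ isT).
by rewrite mulf_eq0 orbb => /eqP.
Qed.

Lemma gram_mul (R : realType) d k (u : 'I_k -> 'rV[R]_d) :
  gram u = (\matrix_n u n) *m (\matrix_n u n)^T.
Proof.
apply/matrixP => a b; rewrite !mxE; apply: eq_bigr => i _.
by rewrite !mxE.
Qed.

(** If [c *m M *m M^T = 0], then the vector [c *m M] has squared length 0, so [M *m M^T] and [M]
    have the same left kernel. *)
Lemma det_gram_neq0 (R : realType) d k (M : 'M[R]_(k, d)) :
  (\det (M *m M^T) != 0) = row_free M.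
Proof.
rewrite -unitfE -unitmxE -row_free_unit; apply/idP/idP => [|freeM].
  by rewrite /row_free !eqn_leq !rank_leq_row /= => /leq_trans; apply; exact: mxrankM_maxl.
rewrite -kermx_eq0; apply/eqP/row_matrixP => i; rewrite row0.
have : row i (kermx (M *m M^T)) *m (M *m M^T) = 0.
  by rewrite -row_mul mulmx_ker row0.
move: (row _ _) => c cMM; apply/(row_free_inj freeM)/eqP.
rewrite mul0mx -dotvv_eq0 dotv_mul trmx_mul !mulmxA -(mulmxA c) cMM.
by rewrite mul0mx mxE.
Qed.

(** The selection matrix [rowsub e 1%:M] times its transpose is the identity, so it has full row
    rank, and multiplication on the right by a row-free [M] preserves rank. *)
Lemma row_free_rowsub (R : realType) d k l (e : 'I_l -> 'I_k)
    (M : 'M[R]_(k, d)) : injective e -> row_free M -> row_free (rowsub e M).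
Proof.
move=> inje freeM; rewrite rowsubE /row_free mxrankMfree //.
have : rowsub e (1%:M : 'M[R]_k) *m (rowsub e 1%:M)^T = 1%:M.
  rewrite mul_rowsub_mx mul1mx; apply/matrixP => a b.
  by rewrite !mxE (inj_eq inje) eq_sym.
rewrite -/(row_free _) => e1; rewrite /row_free eqn_leq rank_leq_row /=.
by have := mxrankM_maxl (rowsub e (1%:M : 'M[R]_k)) (rowsub e 1%:M)^T; rewrite e1 mxrank1.
Qed.

(** The identity [wedge_norm_gram] between square roots does not by itself exclude a negative
    determinant. But a nonzero determinant makes the rows free, hence some maximal minor nonzero and
    [wedge_norm M] positive, and [Num.sqrt] is positive only on positive numbers. *)
Lemma det_gram_ge0 (R : realType) d k (M : 'M[R]_(k, d)) :
  0 <= \det (M *m M^T).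
Proof.
have [|] := eqVneq (\det (M *m M^T)) 0; first by move->.
rewrite det_gram_neq0 => freeM.
have fullMT : row_full M^T by rewrite /row_full mxrank_tr.
pose f := fullrankfun fullMT.
have injf : injective f by exact: fullrankfun_inj.
(* Only increasing column selections occur in [wedge_norm], so the independent columns chosen by [f]
   are listed in increasing order. *)
have [g incg gf] := increasing_exists injf.
have gunit : \det (colsub g M) != 0.
  rewrite -det_tr -unitfE -unitmxE -row_full_unit.
  have := fullrowsub_full fullMT; rewrite -/f.
  rewrite -!sub1mx => /submx_trans; apply; apply/row_subP => a; rewrite row_rowsub.
  have : f a \in g @: 'I_k by rewrite gf imset_f.
  case/imsetP => b _ ->.
  have -> : row (g b) M^T = row b (colsub g M)^T by apply/rowP => i; rewrite !mxE.
  exact: row_sub.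
have : 0 < wedge_norm M.
  rewrite sqrtr_gt0 (bigD1 g) //= ltr_wpDr //.
    by apply: sumr_ge0 => h _; exact: sqr_ge0.
  by rewrite lt_def sqr_ge0 expf_neq0.
rewrite wedge_norm_gram sqrtr_gt0 gram_mul => /ltW.
by congr (0 <= \det _); congr (_ *m _^T); apply/matrixP => a b; rewrite !mxE.
Qed.

(** * Products of real powers and the weighted AM-GM inequality *)

Lemma powR_prod (R : realType) (I : finType) (P : pred I) (x : I -> R) (r : R) :
  (forall i, P i -> 0 <= x i) ->
  (\prod_(i | P i) x i) `^ r = \prod_(i | P i) x i `^ r.
Proof.
move=> x0; suff [] : (\prod_(i | P i) x i) `^ r = \prod_(i | P i) x i `^ r /\
  0 <= \prod_(i | P i) x i by [].
elim/big_rec2 : _ => [|i y z Pi [<- z0]]; first by rewrite powR1.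
by rewrite powRM ?x0 // mulr_ge0 ?x0.
Qed.

Lemma prod_powR_sum1 (R : realType) (I : finType) (P : pred I) (a : I -> R)
    (x : R) : (forall i, P i -> 0 < a i) -> \sum_(i | P i) a i = 1 -> 0 <= x ->
  \prod_(i | P i) x `^ a i = x.
Proof.
move=> a0 a1; rewrite le_eqVlt => /predU1P[<-|x0].
  have [i Pi|P0] := pickP P.
    by rewrite (bigD1 i) //= powR0 ?mul0r // gt_eqF // a0.
  by have := oner_neq0 R; rewrite -a1 big1 ?eqxx // => i; rewrite P0.
under eq_bigr do rewrite /powR gt_eqF //.
by rewrite -expR_sum -mulr_suml a1 mul1r lnK.
Qed.

Lemma weighted_AMGM (R : realType) (I : finType) (P : pred I) (a x : I -> R) :
  (forall i, P i -> 0 < a i) -> \sum_(i | P i) a i = 1 ->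
  (forall i, P i -> 0 <= x i) ->
  \prod_(i | P i) x i `^ a i <= \sum_(i | P i) a i * x i.
Proof.
move=> a0 a1 x0; set s := \sum_(i | P i) a i * x i.
have ax0 i : P i -> 0 <= a i * x i by move=> Pi; rewrite mulr_ge0 ?x0 ?(ltW (a0 _ Pi)).
have s0 : 0 <= s by apply: sumr_ge0.
have [s_eq0|s_neq0] := eqVneq s 0.
  have [i Pi|P0] := pickP P; last first.
    by have := oner_neq0 R; rewrite -a1 big1 ?eqxx // => i; rewrite P0.
  have /eqP := psumr_eq0P ax0 s_eq0 Pi.
  rewrite mulf_eq0 (gt_eqF (a0 _ Pi)) /= => /eqP xi0.
  by rewrite (bigD1 i) //= xi0 powR0 ?mul0r // gt_eqF // a0.
have sp : 0 < s by rewrite lt_def s_neq0.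
(* [x i / s <= expR (x i / s - 1)], and the exponents weighted by [a] add up to 0. *)
have -> : \prod_(i | P i) x i `^ a i = s * \prod_(i | P i) (x i / s) `^ a i.
  rewrite -[X in X * _](prod_powR_sum1 a0 a1 s0).
  rewrite -big_split /=; apply: eq_bigr => i Pi.
  by rewrite -powRM ?divr_ge0 ?x0 // mulrC divfK.
rewrite ler_piMr //.
have : \prod_(i | P i) (x i / s) `^ a i <=
       \prod_(i | P i) expR (a i * (x i / s - 1)).
  apply: ler_prod => i Pi; rewrite powR_ge0 /= [a i * _]mulrC expRM.
  apply: ge0_ler_powR; rewrite ?nnegrE ?expR_ge0 ?divr_ge0 ?x0 ?(ltW (a0 _ Pi)) //.
  by rewrite (le_trans _ (expR_ge1Dx _)) // addrC subrK.
move/le_trans; apply; rewrite -expR_sum.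
under eq_bigr do rewrite mulrBr mulr1 mulrA.
by rewrite sumrB -mulr_suml -/s a1 divff // subrr expR0.
Qed.

(** * Hölder's inequality for several functions with extended real values *)

Local Open Scope ereal_scope.

Lemma poweR_prod (R : realType) (I : finType) (P : pred I) (x : I -> \bar R)
    (r : R) : (forall i, P i -> 0 <= x i) ->
  (\prod_(i | P i) x i) `^ r = \prod_(i | P i) x i `^ r.
Proof.
move=> x0; suff [] : (\prod_(i | P i) x i) `^ r = \prod_(i | P i) x i `^ r /\
  0 <= \prod_(i | P i) x i by [].
elim/big_rec2 : _ => [|i y z Pi [<- z0]]; first by rewrite poweR1r.
by rewrite poweRM ?x0 // mule_ge0 ?x0.
Qed.

Lemma prode_eq0 (R : realType) (I : finType) (P : pred I) (x : I -> \bar R)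
    (i : I) : P i -> x i = 0 -> \prod_(i | P i) x i = 0.
Proof. by move=> Pi xi; rewrite (bigD1 i) //= xi mul0e. Qed.

Lemma prode_gt0 (R : realType) (I : finType) (P : pred I) (x : I -> \bar R) :
  (forall i, P i -> 0 < x i) -> 0 < \prod_(i | P i) x i.
Proof. by move=> x0; elim/big_ind : _ => // y z; exact: mule_gt0. Qed.

Lemma prode_eqy (R : realType) (I : finType) (P : pred I) (x : I -> \bar R)
    (i : I) : (forall i, P i -> 0 < x i) -> P i -> x i = +oo ->
  \prod_(i | P i) x i = +oo.
Proof.
move=> x0 Pi xi; rewrite (bigD1 i) //= xi gt0_mulye // prode_gt0 //.
by move=> k /andP[/x0].
Qed.

(** Weighted AM-GM for the ratios [x i / c i]; an infinite [x i] makes the right-hand side [+oo].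
    The right-hand side is linear in [x], hence easy to integrate, and the scales [c i] are chosen
    in [hoelder_prod]. *)
Lemma scaled_AMGM (R : realType) (I : finType) (P : pred I) (a c : I -> R)
    (x : I -> \bar R) :
  (forall i, P i -> (0 < a i)%R) -> (\sum_(i | P i) a i = 1)%R ->
  (forall i, P i -> (0 < c i)%R) -> (forall i, 0 <= x i) ->
  \prod_(i | P i) x i `^ a i <=
  (\prod_(i | P i) c i `^ a i)%R%:E * \sum_(i | P i) (a i / c i)%:E * x i.
Proof.
move=> a0 a1 c0 x0.
have cp : (0 < \prod_(i | P i) c i `^ a i)%R.
  by apply: prodr_gt0 => i Pi; rewrite powR_gt0 // c0.
have [i /andP[Pi /eqP xi]|xfin] := pickP (fun i => P i && (x i == +oo)).
  rewrite [X in _ * X](_ : _ = +oo) ?gt0_muley ?leey ?lte_fin //.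
  rewrite (bigD1 i) //= xi gt0_muley ?lte_fin ?divr_gt0 ?a0 ?c0 // addye //.
  rewrite gt_eqF // (@lt_le_trans _ _ 0) ?ltNy0 // sume_ge0 // => k /andP[Pk _].
  by rewrite mule_ge0 // lee_fin divr_ge0 // ltW ?a0 ?c0.
have xE i : P i -> x i = (fine (x i))%:E.
  move=> Pi; rewrite fineK // ge0_fin_numE // lt_neqAle leey andbT.
  by have := xfin i; rewrite Pi /= => ->.
have -> : \prod_(i | P i) x i `^ a i = \prod_(i | P i) (fine (x i) `^ a i)%:E.
  by apply: eq_bigr => i Pi; rewrite [in LHS]xE.
have -> : \sum_(i | P i) (a i / c i)%:E * x i =
    \sum_(i | P i) (a i / c i * fine (x i))%:E.
  by apply: eq_bigr => i Pi; rewrite [in LHS]xE.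
rewrite prodEFin sumEFin -EFinM lee_fin.
have r0 i : (0 <= fine (x i))%R by rewrite fine_ge0.
have -> : (\prod_(i | P i) fine (x i) `^ a i = \prod_(i | P i) c i `^ a i *
    \prod_(i | P i) (fine (x i) / c i) `^ a i)%R.
  rewrite -big_split /=; apply: eq_bigr => i Pi; have ci := c0 _ Pi.
  by rewrite -powRM ?divr_ge0 ?(ltW ci) // mulrC divfK ?gt_eqF.
rewrite ler_pM2l // (le_trans (weighted_AMGM a0 a1 _)) //.
  by move=> i Pi; rewrite divr_ge0 // ltW // c0.
by apply: ler_sum => i _; rewrite mulrA mulrAC.
Qed.

Lemma emeasurable_prod d (T : measurableType d) (R : realType) (I : finType)
    (P : pred I) (f : I -> T -> \bar R) :
  (forall i, P i -> measurable_fun [set: T] (f i)) ->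
  measurable_fun [set: T] (fun t => \prod_(i | P i) f i t).
Proof.
move=> mf; under eq_fun do rewrite big_mkcond /=.
elim: (index_enum I) => [|i s ih].
  by under eq_fun do rewrite big_nil; exact: measurable_cst.
under eq_fun do rewrite big_cons; apply: emeasurable_funM => //.
by case: (boolP (P i)) => [/mf|].

Qed.

Lemma measurable_poweRT d (T : measurableType d) (R : realType)
    (f : T -> \bar R) (r : R) :
  measurable_fun [set: T] f -> measurable_fun [set: T] (fun t => f t `^ r).
Proof. by move=> mf; exact: (measurableT_comp (measurable_poweR r) mf). Qed.

(** When all integrals are positive and finite, [scaled_AMGM] is integrated with [c i] the integral
    of [f i]: the sum on the right then integrates to the sum of the weights, which is 1. *)
Lemma hoelder_prod d (T : measurableType d) (R : realType)
    (mu : {measure set T -> \bar R}) (I : finType) (P : pred I) (a : I -> R)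
    (f : I -> T -> \bar R) :
  (forall i, P i -> (0 < a i)%R) -> (\sum_(i | P i) a i = 1)%R ->
  (forall i, measurable_fun [set: T] (f i)) -> (forall i t, 0 <= f i t) ->
  \int[mu]_t (\prod_(i | P i) f i t `^ a i) <=
  \prod_(i | P i) (\int[mu]_t f i t) `^ a i.
Proof.
move=> a0 a1 mf f0; set J := fun i => \int[mu]_t f i t.
have J0 i : 0 <= J i by apply: integral_ge0.
have mprod : measurable_fun [set: T] (fun t => \prod_(i | P i) f i t `^ a i).
  by apply: emeasurable_prod => i _; exact: measurable_poweRT.
have [i /andP[Pi /eqP Ji]|Jn0] := pickP (fun i => P i && (J i == 0)).
  (* A nonnegative function with integral 0 vanishes almost everywhere, and so does the product. *)
  have -> : \int[mu]_t (\prod_(i | P i) f i t `^ a i) = \int[mu]_t cst 0 t.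
    apply: ge0_ae_eq_integral => //.
      by move=> t _; apply: prode_ge0 => k _; exact: poweR_ge0.
    have : \int[mu]_t `|f i t| = 0.
      by rewrite -Ji; apply: eq_integral => t _; rewrite gee0_abs.
    move/(ae_eq_integral_abs mu measurableT (mf i)); apply: filterS => t fi _.
    by apply: (prode_eq0 Pi); rewrite fi // poweR0r // gt_eqF // a0.
  by rewrite integral0; apply: prode_ge0 => k _; exact: poweR_ge0.
have {Jn0}Jp i : P i -> 0 < J i.
  by move=> Pi; rewrite lt_def J0 andbT; have := Jn0 i; rewrite Pi /= => ->.
have [i /andP[Pi /eqP Ji]|Jfin] := pickP (fun i => P i && (J i == +oo)).
  (* All factors are now positive, so one infinite factor makes the product infinite. *)
  rewrite (_ : \prod_(i | P i) J i `^ a i = +oo) ?leey //.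
  apply: (prode_eqy _ Pi) => [k Pk|]; first by rewrite poweR_gt0 // Jp.
  by rewrite Ji poweRyr // gt_eqF // a0.
pose c i := fine (J i).
have JE i : P i -> J i = (c i)%:E.
  move=> Pi; rewrite fineK // ge0_fin_numE // lt_neqAle leey andbT.
  by have := Jfin i; rewrite Pi /= => ->.
have c0 i : P i -> (0 < c i)%R by move=> Pi; rewrite -lte_fin -JE ?Jp.
have ac0 i : P i -> (0 <= a i / c i)%R.
  by move=> Pi; rewrite divr_ge0 // ltW ?a0 ?c0.
(* Outside [P] the sign of [a i / c i] is unknown; the value 0 there keeps every [g i]
   nonnegative. *)
pose g i t := if P i then (a i / c i)%:E * f i t else 0.
have mg i : measurable_fun [set: T] (g i).
  by rewrite /g; case: (boolP (P i)) => // Pi; exact: measurable_funeM.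
have g0 i t : 0 <= g i t.
  by rewrite /g; case: ifP => // Pi; rewrite mule_ge0 // lee_fin ac0.
set K := (\prod_(i | P i) c i `^ a i)%R.
have K0 : (0 <= K)%R by apply: prodr_ge0 => i _; exact: powR_ge0.
apply: (@le_trans _ _ (\int[mu]_t (K%:E * \sum_i g i t))).
  apply: ge0_le_integral => //.
  - by move=> t _; apply: prode_ge0 => i _; exact: poweR_ge0.
  - by apply: measurable_funeM; exact: emeasurable_sum.
  - by move=> t _; rewrite -big_mkcond; exact: scaled_AMGM.
rewrite ge0_integralZl //; last 2 first.
- exact: emeasurable_sum.
- by move=> t _; apply: sume_ge0.
rewrite ge0_integral_sum //.
have -> : \sum_i \int[mu]_t g i t = 1.
  transitivity (\sum_(i | P i) (a i)%:E); last by rewrite sumEFin a1.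
  rewrite [RHS]big_mkcond; apply: eq_bigr => i _; rewrite /g.
  case: (boolP (P i)) => Pi; last by rewrite integral0.
  rewrite ge0_integralZl ?lee_fin ?ac0 // -/(J i) JE // -EFinM divfK //.
  by rewrite gt_eqF // c0.
rewrite mule1 /K -prodEFin le_eqVlt; apply/orP; left; apply/eqP.
by apply: eq_bigr => i Pi; rewrite -/(J i) JE // poweR_EFin.
Qed.

(** The integral of a nonnegative function is a supremum over the simple functions below it, and
    enlarging the function enlarges this set. *)
Lemma le_integral_nonneg d (T : measurableType d) (R : realType)
    (mu : {measure set T -> \bar R}) (f g : T -> \bar R) :
  (forall t, 0 <= f t) -> (forall t, f t <= g t) ->
  \int[mu]_t f t <= \int[mu]_t g t.
Proof.
move=> f0 fg; have g0 t : 0 <= g t := le_trans (f0 t) (fg t).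
rewrite !ge0_integralTE //; apply: ereal_sup_le => _ [h hf <-].
by exists h => // t; exact: le_trans (hf t) (fg t).
Qed.

(* Borel measurability on ['M[R]_(k, d)], which carries no sigma-algebra in the
   library, tested by composition with coordinatewise measurable maps. *)
Definition mx_measurable (R : realType) k d (F : 'M[R]_(k, d) -> \bar R) :=
  forall disp (T : measurableType disp) (g : T -> 'M[R]_(k, d)),
    (forall a b, measurable_fun [set: T] (fun t => g t a b)) ->
    measurable_fun [set: T] (fun t => F (g t)).

(** * Iterated integrals of functions of a matrix, and Finner's inequality *)

Section IteratedIntegral.
Context (R : realType) (d : nat).
Implicit Types (k l : nat).

Definition integrate_row k (S : hypersurface R d)
    (F : 'M[R]_(k.+1, d) -> \bar R) (M : 'M[R]_(k, d)) : \bar R :=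
  \int[hs_measure S]_x F (col_mx (hs_vec x) M : 'M[R]_(1 + k, d)).

Lemma col_mx_entry k (v : 'rV[R]_d) (M : 'M[R]_(k, d)) (a : 'I_k.+1) b :
  (col_mx v M : 'M[R]_(1 + k, d)) a b =
  if unlift ord0 a is Some a' then M a' b else v 0%R b.
Proof.
case: unliftP => [a' ->|->].
  have -> : lift ord0 a' = rshift 1 a' by apply/val_inj.
  by rewrite col_mxEd.
have -> : ord0 = lshift k (ord0 : 'I_1) by apply/val_inj.
by rewrite col_mxEu.
Qed.

Lemma measurable_col_mx disp (T : measurableType disp) k (f : T -> 'rV[R]_d)
    (g : T -> 'M[R]_(k, d)) :
  (forall b, measurable_fun [set: T] (fun t => f t 0%R b)) ->
  (forall a b, measurable_fun [set: T] (fun t => g t a b)) ->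
  forall (a : 'I_k.+1) b,
    measurable_fun [set: T] (fun t => (col_mx (f t) (g t) : 'M[R]_(1 + k, d)) a b).
Proof.
move=> mf mg a b; under eq_fun do rewrite col_mx_entry.
by case: (unlift ord0 a) => [a'|]; [exact: mg|exact: mf].
Qed.

Lemma mx_measurable_row k (S : hypersurface R d) (F : 'M[R]_(k.+1, d) -> \bar R)
    (M : 'M[R]_(k, d)) : mx_measurable F ->
  measurable_fun [set: S] (fun x => F (col_mx (hs_vec x) M : 'M[R]_(1 + k, d))).
Proof.
move=> mF; apply: (mF _ S (fun x => col_mx (hs_vec x) M)) => a b.
apply: (measurable_col_mx (f := @hs_vec _ _ S) (g := cst M)) => //.
exact: hs_vec_measurable.
Qed.

(** Tonelli's theorem on [T * S]: the test map [g] on [T], extended by the row [hs_vec], is a test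
    map on the product space. *)
Lemma mx_measurable_integrate_row k (S : hypersurface R d)
    (F : 'M[R]_(k.+1, d) -> \bar R) :
  mx_measurable F -> (forall M, 0 <= F M) -> mx_measurable (integrate_row S F).
Proof.
move=> mF F0 disp T g mg.
pose f (z : T * S) := F (col_mx (hs_vec z.2) (g z.1) : 'M[R]_(1 + k, d)).
have mf : measurable_fun [set: T * S] f.
  apply: (mF _ (T * S)%type (fun z => col_mx (hs_vec z.2) (g z.1))) => a b.
  apply: (measurable_col_mx (f := fun z => hs_vec z.2) (g := fun z => g z.1)).
    move=> c; apply: (measurableT_comp (f := fun x => hs_vec x 0%R c)) => //.
    exact: hs_vec_measurable.
  by move=> a' c; apply: (measurableT_comp (f := fun x => g x a' c)).
exact: (measurable_fun_fubini_tonelli_F (m2 := hs_measure S) f mf (fun z => F0 _)).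
Qed.

Lemma iterated_integral_ge0 k (S : 'I_k -> hypersurface R d)
    (F : 'M[R]_(k, d) -> \bar R) :
  (forall M, 0 <= F M) -> 0 <= iterated_integral S F.
Proof.
elim: k S F => [|k ih] S F F0 //=.
by apply: ih => M; apply: integral_ge0.
Qed.

(** The comparison is asked only at matrices whose rows are values of the hypersurfaces, since the
    supremum of [rho] controls nothing elsewhere. *)
Lemma le_iterated_integral k (S : 'I_k -> hypersurface R d)
    (F G : 'M[R]_(k, d) -> \bar R) :
  (forall M, (forall n, exists x : S n, row n M = hs_vec x) ->
    0 <= F M <= G M) ->
  iterated_integral S F <= iterated_integral S G.
Proof.
elim: k S F G => [|k ih] S F G FG /=.
  suff /FG/andP[] : forall n, exists x : S n,
    row n (0%R : 'M[R]_(0, d)) = hs_vec x by [].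
  by case.
apply: ih => M HM.
have FGx (x : S ord0) : 0 <= F (col_mx (hs_vec x) M : 'M[R]_(1 + k, d))
    <= G (col_mx (hs_vec x) M : 'M[R]_(1 + k, d)).
  apply: FG => n; case: (unliftP ord0 n) => [n' ->|->].
    have [y yM] := HM n'; exists y; rewrite -yM.
    by apply/rowP => b; rewrite [LHS]mxE [RHS]mxE col_mx_entry liftK.
  by exists x; apply/rowP => b; rewrite mxE col_mx_entry unlift_none.
apply/andP; split.
  by apply: integral_ge0 => x _; have /andP[] := FGx x.
by apply: le_integral_nonneg => x; have /andP[] := FGx x.
Qed.

Lemma iterated_integralZl k (S : 'I_k -> hypersurface R d)
    (F : 'M[R]_(k, d) -> \bar R) (c : \bar R) :
  0 <= c -> mx_measurable F -> (forall M, 0 <= F M) ->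
  iterated_integral S (fun M => c * F M) = c * iterated_integral S F.
Proof.
move=> c0; elim: k S F => [|k ih] S F mF F0 //=.
rewrite -ih; last 2 first.
- exact: mx_measurable_integrate_row.
- by move=> M; apply: integral_ge0.
congr iterated_integral; apply/funext => M.
by rewrite ge0_integralZl //; exact: mx_measurable_row.
Qed.

(* Integrates only over the rows selected by [b], the other rows being set to
   [0]; thus all the integrands of a cover share the matrix type, and no cast
   between the cardinals of index sets is needed. *)
Fixpoint masked_integral k : ('I_k -> hypersurface R d) -> ('I_k -> bool) ->
    ('M[R]_(k, d) -> \bar R) -> \bar R :=
  match k with
  | 0 => fun _ _ F => F 0%R
  | k'.+1 => fun S b F =>
      masked_integral (fun n => S (lift ord0 n)) (fun n => b (lift ord0 n))
        (if b ord0 then integrate_row (S ord0) F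
         else fun M => F (col_mx 0%R M : 'M[R]_(1 + k', d)))
  end.

Definition supported_on k (b : 'I_k -> bool) (F : 'M[R]_(k, d) -> \bar R) :=
  forall M N, (forall n, b n -> row n M = row n N) -> F M = F N.

Lemma supported_integrate_row k (S : hypersurface R d) (b : 'I_k.+1 -> bool)
    (F : 'M[R]_(k.+1, d) -> \bar R) : supported_on b F ->
  supported_on (fun n => b (lift ord0 n))
    (if b ord0 then integrate_row S F
     else fun M => F (col_mx 0%R M : 'M[R]_(1 + k, d))).
Proof.
move=> sF M N MN.
have H v : F (col_mx v M : 'M[R]_(1 + k, d)) = F (col_mx v N : 'M[R]_(1 + k, d)).
  apply: sF => n bn; apply/rowP => i; rewrite [LHS]mxE [RHS]mxE !col_mx_entry.
  move: bn; case: (unliftP ord0 n) => [n' ->|//] /MN/rowP/(_ i).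
  by rewrite !mxE.
by case: ifP => _; [apply: eq_integral => x _|]; rewrite H.
Qed.

(** Induction on the number of rows. Each [F i] is replaced by [F' i], a function of the remaining
    rows: the integral over the first row if [b i] selects it, the value with first row 0
    otherwise. *)
Lemma Finner k (S : 'I_k -> hypersurface R d) m (b : 'I_m -> 'I_k -> bool)
    (a : 'I_m -> R) (F : 'I_m -> 'M[R]_(k, d) -> \bar R) :
  (forall i, (0 < a i)%R) ->
  (forall n, \sum_(i < m | b i n) a i = 1)%R ->
  (forall i, mx_measurable (F i)) -> (forall i M, 0 <= F i M) ->
  (forall i, supported_on (b i) (F i)) ->
  iterated_integral S (fun M => \prod_(i < m) F i M `^ a i) <=
  \prod_(i < m) masked_integral S (b i) (F i) `^ a i.
Proof.
move=> a0; elim: k S b F => [|k ih] S b F a1 mF F0 sF //=.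
set F' := fun i => if b i ord0 then integrate_row (S ord0) (F i)
  else fun M => F i (col_mx 0%R M : 'M[R]_(1 + k, d)).
have F'0 i M : 0 <= F' i M.
  by rewrite /F'; case: ifP => // _; apply: integral_ge0.
have mF' i : mx_measurable (F' i).
  rewrite /F'; case: ifP => [_|_ disp T g mg].
    exact: mx_measurable_integrate_row.
  apply: (mF i _ _ (fun t => col_mx (0%R : 'rV[R]_d) (g t))).
  by apply: (measurable_col_mx (f := cst 0%R)) => // c; exact: measurable_cst.
have sF' i : supported_on (fun n => b i (lift ord0 n)) (F' i).
  exact: supported_integrate_row.
(* The induction hypothesis bounds the iterated integral of the product of the [F' i]; what remains
   is an inequality for the first variable alone, with [M] fixed. *)
apply: le_trans (ih _ _ F' (fun n => a1 (lift ord0 n)) mF' F'0 sF').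
apply: le_iterated_integral => M _; apply/andP; split.
  by apply: integral_ge0 => x _; apply: prode_ge0 => i _; exact: poweR_ge0.
(* Factors independent of the first row leave the integral; the exponents of the others add up to 1,
   so Hölder's inequality applies to them. *)
under eq_integral do rewrite (bigID (fun i => ~~ b i ord0)) /=.
rewrite [X in _ <= X](bigID (fun i => ~~ b i ord0)) /=.
have Fout i (x : S ord0) : ~~ b i ord0 ->
    F i (col_mx (hs_vec x) M : 'M[R]_(1 + k, d)) = F' i M.
  move=> bi; rewrite /F' (negbTE bi); apply: sF => n bn.
  apply/rowP => c; rewrite [LHS]mxE [RHS]mxE !col_mx_entry.
  by move: bn; case: (unliftP ord0 n) => // ->; rewrite (negbTE bi).
under eq_integral => x _.
  under eq_bigr => i bi do rewrite (Fout _ _ bi).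
  over.
have P0 : 0 <= \prod_(i < m | ~~ b i ord0) F' i M `^ a i.
  by apply: prode_ge0 => i _; exact: poweR_ge0.
rewrite ge0_integralZl //; last 2 first.
- apply: emeasurable_prod => i _; apply: measurable_poweRT.
  exact: mx_measurable_row.
- by move=> x _; apply: prode_ge0 => i _; exact: poweR_ge0.
apply: lee_pmul => //.
  by apply: integral_ge0 => x _; apply: prode_ge0 => i _; exact: poweR_ge0.
have -> : \prod_(i < m | ~~ ~~ b i ord0) F' i M `^ a i =
    \prod_(i < m | ~~ ~~ b i ord0) integrate_row (S ord0) (F i) M `^ a i.
  by apply: eq_bigr => i /negPn bi; rewrite /F' bi.
apply: (@hoelder_prod _ _ _ _ _ _ _
  (fun i x => F i (col_mx (hs_vec x) M : 'M[R]_(1 + k, d)))) => //.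
- by under eq_bigl do rewrite negbK.
- by move=> i; exact: mx_measurable_row.
Qed.

(** Identifies the masked integral with the integral over the subfamily indexed by [e]. The
    induction on [k] distinguishes whether the first row is in the image of [e]; monotonicity of [e]
    keeps the order of integration. *)
Lemma masked_integral_rowsub k l (S : 'I_k -> hypersurface R d)
    (e : 'I_l -> 'I_k) (F : 'M[R]_(l, d) -> \bar R) :
  {homo e : x y / (x < y)%N} ->
  masked_integral S (fun n => [exists a, e a == n]) (fun M => F (rowsub e M)) =
  iterated_integral (fun a => S (e a)) F.
Proof.
elim: k l S e F => [|k ih] l S e F ince.
  case: l e F ince => [|l] e F ince; last by case: (e ord0).
  by rewrite /=; congr F; apply/matrixP; case.
(* If [e] misses the first row, it factors through [lift ord0], and that row is the one set to 0. *)
case: (pickP (fun a => e a == ord0)) => [a0 /eqP ea0|en0]; last first.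
  have eE a : {e' | e a = lift ord0 e'}.
    by case: (unliftP ord0 (e a)) (en0 a) => [e' ->|->]; [exists e'|].
  pose e' a := sval (eE a).
  have e'E a : e a = lift ord0 (e' a) by rewrite /e'; case: (eE a).
  have ince' : {homo e' : x y / (x < y)%N}.
    by move=> x y /ince; rewrite !e'E !lift0 ltnS.
  rewrite /= ifF; last by apply/existsP => -[a]; rewrite en0.
  rewrite [RHS](_ : _ = iterated_integral (fun a => S (lift ord0 (e' a))) F); last first.
    by congr iterated_integral; apply/funext => a; rewrite e'E.
  rewrite -(ih _ (fun n => S (lift ord0 n)) e' F ince'); congr masked_integral.
    apply/funext => n; apply: eq_existsb => a.
    by rewrite e'E (inj_eq lift_inj).
  apply/funext => M; congr F; apply/matrixP => a c.
  by rewrite [LHS]mxE [RHS]mxE col_mx_entry e'E liftK.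
case: l e F ince a0 ea0 => [|l] e F ince a0 ea0; first by case: a0 {ea0}.
(* The least value [ord0] of an increasing map can only be taken at the first index. *)
have e0 : e ord0 = ord0.
  case: (unliftP ord0 a0) ea0 => [a ->|-> //] ea.
  by have := ince ord0 (lift ord0 a) isT; rewrite ea ltn0.
have eE a : {e' | e (lift ord0 a) = lift ord0 e'}.
  case: (unliftP ord0 (e (lift ord0 a))) => [e' ->|ea]; first by exists e'.
  by have := ince ord0 (lift ord0 a) isT; rewrite ea ltn0.
pose e' a := sval (eE a).
have e'E a : e (lift ord0 a) = lift ord0 (e' a) by rewrite /e'; case: (eE a).
have ince' : {homo e' : x y / (x < y)%N}.
  move=> x y xy; have : (lift ord0 x < lift ord0 y)%N by rewrite !lift0 ltnS.
  by move=> /ince; rewrite !e'E !lift0 ltnS.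
rewrite /= ifT; last by apply/existsP; exists ord0; rewrite e0.
have -> : (fun n => S (e (lift ord0 n))) = (fun n => S (lift ord0 (e' n))).
  by apply/funext => a; rewrite e'E.
rewrite e0 -(ih _ (fun n => S (lift ord0 n)) e' _ ince'); congr masked_integral.
  apply/funext => n; apply/existsP/existsP => -[a /eqP ea].
    case: (unliftP ord0 a) ea => [a' ->|->]; last by rewrite e0.
    by rewrite e'E => /lift_inj <-; exists a'.
  by exists (lift ord0 a); rewrite e'E ea.
apply/funext => M; apply: eq_integral => x _; congr F; apply/matrixP => a c.
rewrite mxE !col_mx_entry; case: (unliftP ord0 a) => [a' ->|->].
  by rewrite e'E liftK mxE.
by rewrite e0 unlift_none.
Qed.

End IteratedIntegral.

(** * The pointwise identity between wedge norms and the determinant ratio *)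

Local Open Scope ring_scope.

Lemma homo_enum_val k (A : {set 'I_k}) :
  {homo (@enum_val _ (mem A)) : x y / (x < y)%N}.
Proof.
move=> x y xy; have x0 := enum_val x; rewrite !(enum_val_nth x0).
apply: (sorted_ltn_nth (leT := fun x y : 'I_k => (x < y)%N)) => //.
- by move=> ? ? ?; exact: ltn_trans.
- have -> : enum (mem A) = [seq x <- enum 'I_k | x \in A] by rewrite [in RHS]enumT.
  apply: sorted_filter; first by move=> ? ? ?; exact: ltn_trans.
  by have := iota_ltn_sorted 0 k; rewrite -val_enum_ord sorted_map.
- by rewrite inE -cardE ltn_ord.
- by rewrite inE -cardE ltn_ord.
Qed.

(** The Gram matrix of the scaled vectors is [D *m gram w *m D] with [D] diagonal, so its
    determinant gains the square of the product of the [N n]. *)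
Lemma wedge_norm_scale (R : realType) d k (N : 'I_k -> R) (w : 'I_k -> 'rV[R]_d) :
  (forall n, 0 <= N n) ->
  wedge_norm (\matrix_n (N n *: w n)) =
  (\prod_n N n) * Num.sqrt (\det (gram w)).
Proof.
move=> N0; rewrite wedge_norm_gram.
have -> : gram (fun a => row a (\matrix_n (N n *: w n))) =
    diag_mx (\row_n N n) *m gram w *m diag_mx (\row_n N n).
  apply/matrixP => a b; rewrite mul_mx_diag mxE mxE mul_diag_mx !mxE.
  rewrite /dotv mulr_sumr mulr_suml; apply: eq_bigr => i _; rewrite !mxE.
  by rewrite mulrACA mulrAC.
rewrite !det_mulmx det_diag mulrAC -expr2.
under eq_bigr do rewrite mxE.
by rewrite sqrtrM ?sqr_ge0 // sqrtr_sqr ger0_norm // prodr_ge0.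
Qed.

Lemma principal_submx_gram (R : realType) d k (A : {set 'I_k})
    (w : 'I_k -> 'rV[R]_d) :
  principal_submx A (gram w) = gram (fun a : 'I_#|A| => w (enum_val a)).
Proof. by apply/matrixP => a b; rewrite !mxE. Qed.

(** A subfamily of independent vectors is independent. By contraposition, wherever [det_ratio] takes
    its default value 0, the full Gram determinant vanishes too. *)
Lemma det_gram_subfamily_neq0 (R : realType) d k (A : {set 'I_k})
    (w : 'I_k -> 'rV[R]_d) :
  \det (gram w) != 0 -> \det (principal_submx A (gram w)) != 0.
Proof.
rewrite principal_submx_gram !gram_mul !det_gram_neq0.
move=> /(row_free_rowsub (@enum_val_inj _ (mem A))).
by congr (row_free _); apply/matrixP => a b; rewrite !mxE.
Qed.

Lemma wedge_norm_ratio (R : realType) d j m (A : 'I_m -> {set 'I_j})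
    (alpha : 'I_m -> R) (N : 'I_j -> R) (w : 'I_j -> 'rV[R]_d) :
  uniform_cover A alpha -> (forall n, 0 <= N n) ->
  let M := \matrix_n (N n *: w n) in
  wedge_norm M = det_ratio A alpha (gram w) *
    \prod_(i < m) wedge_norm (rowsub (@enum_val _ (mem (A i))) M) `^ alpha i.
Proof.
move=> [_ alpha0 cover] N0 M; rewrite /M wedge_norm_scale // /det_ratio.
case: ifPn => [/existsP[i /eqP Di0]|].
  rewrite mul0r; have [->|] := eqVneq (\det (gram w)) 0.
    by rewrite sqrtr0 mulr0.
  by move=> /(det_gram_subfamily_neq0 (A i)); rewrite Di0 eqxx.
rewrite negb_exists => /forallP D0.
have wE i : wedge_norm (rowsub (@enum_val _ (mem (A i))) M) =
    (\prod_(n in A i) N n) * Num.sqrt (\det (principal_submx (A i) (gram w))).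
  have -> : rowsub (@enum_val _ (mem (A i))) M =
      \matrix_a (N (enum_val a) *: w (enum_val a)).
    by apply/matrixP => a b; rewrite !mxE.
  by rewrite wedge_norm_scale // principal_submx_gram [in RHS]big_enum_val.
have Dge0 i : 0 <= \det (principal_submx (A i) (gram w)).
  by rewrite principal_submx_gram gram_mul det_gram_ge0.
have pN0 i : 0 <= \prod_(n in A i) N n by rewrite prodr_ge0.
under [X in _ = _ * X]eq_bigr do rewrite wE powRM ?sqrtr_ge0 //.
rewrite [X in _ = _ * X]big_split /= [RHS]mulrCA; congr (_ * _).
  (* The exponents [alpha i] of each [N n] add up to 1 by uniformity of the cover. *)
  transitivity (\prod_n \prod_(i | n \in A i) N n `^ alpha i).
    apply: eq_bigr => n _; rewrite prod_powR_sum1 //.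
    rewrite -[RHS](cover n) [LHS]big_mkcond; apply: eq_bigr => i _.
    by case: ifP; rewrite ?mulr1 ?mulr0.
  rewrite (exchange_big_dep xpredT) //=; apply: eq_bigr => i _.
  by rewrite powR_prod.
rewrite -[LHS]mulr1 -mulrA; congr (_ * _).
(* [D] equals the denominator of [det_ratio] and is nonzero in this branch, so the two cancel. *)
pose D := \prod_i Num.sqrt (\det (principal_submx (A i) (gram w))) `^ alpha i.
rewrite -[LHS](@mulVf _ D).
  congr (_^-1 * _); apply: eq_bigr => i _.
  by rewrite mulrC powRrM powR12_sqrt.
by apply/prodf_neq0 => i _; rewrite gt_eqF // powR_gt0 // sqrtr_gt0 lt_def D0 Dge0.
Qed.

(** Where the vector is 0 its norm is 0, which cancels the arbitrary direction [u]. *)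
Lemma hs_vecE (R : realType) d (S : hypersurface R d) (u : 'rV[R]_d) (x : S) :
  hs_vec x = normv (hs_vec x) *: vhat u x.
Proof.
rewrite /vhat; have [->|v0] := eqVneq (hs_vec x) 0.
  by rewrite /normv dotv_mul mul0mx mxE sqrtr0 scale0r.
rewrite scalerA divff ?scale1r // gt_eqF // sqrtr_gt0 lt_def dotvv_eq0 v0.
by apply: sumr_ge0 => i _; rewrite -expr2 sqr_ge0.
Qed.

(** The sum of squared minors is a polynomial in the entries; the square root is rewritten as the
    power 1/2. *)
Lemma mx_measurable_wedge_norm (R : realType) d k l (e : 'I_l -> 'I_k) (p : R) :
  mx_measurable (fun M : 'M[R]_(k, d) => (wedge_norm (rowsub e M) `^ p)%:E).
Proof.
move=> disp T g mg; apply/measurable_EFinP.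
apply: (measurableT_comp (measurable_powR p)).
pose h t := \sum_(f : {ffun 'I_l -> 'I_d} | increasing f)
  \det (colsub f (rowsub e (g t))) ^+ 2.
have -> : (fun t => wedge_norm (rowsub e (g t))) = (fun t => h t `^ 2^-1).
  apply/funext => t; rewrite powR12_sqrt //.
  by apply: sumr_ge0 => f _; exact: sqr_ge0.
apply: (measurableT_comp (measurable_powR 2^-1)).
rewrite /h; under eq_fun do rewrite big_mkcond /=.
apply: measurable_sum => f; case: (increasing f) => //.
apply: measurable_funX; apply: measurable_sum => s.
apply: measurable_funM => //; apply: measurable_prod => i _.
by under eq_fun do rewrite !mxE; exact: mg.
Qed.

(** * Integration of the pointwise bound *)

Local Open Scope ereal_scope.

Lemma iterated_integral_empty (R : realType) d k (S : 'I_k -> hypersurface R d)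
    (F : 'M[R]_(k, d) -> \bar R) (n : 'I_k) :
  (S n -> False) -> (forall M, 0 <= F M) -> iterated_integral S F = 0.
Proof.
move=> Sn F0; apply/eqP; rewrite eq_le iterated_integral_ge0 // andbT.
(* Writing the zero integrand as [0 * 0] lets [iterated_integralZl] evaluate it. The comparison with
   it is vacuous, since no row [n] can be a value of an empty hypersurface. *)
have -> : 0 = iterated_integral S (fun=> 0 * 0).
  by rewrite iterated_integralZl ?mul0e // => *; exact: measurable_cst.
by apply: le_iterated_integral => M /(_ n)[x]; have := Sn x.
Qed.

Lemma wedge_norm_powR_le (R : realType) d j m (A : 'I_m -> {set 'I_j})
    (alpha : 'I_m -> R) (S : 'I_j -> hypersurface R d) (u : 'I_j -> 'rV[R]_d)
    (p : R) (c : \bar R) (M : 'M[R]_(j, d)) :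
  (0 < j)%N -> uniform_cover A alpha -> (0 < p)%R ->
  (forall x : forall n, S n, (rho u A alpha x `^ j%:R^-1)%:E <= c) ->
  (forall n, exists x : S n, row n M = hs_vec x) ->
  (wedge_norm M `^ p)%:E <= c `^ (j%:R * p) *
    \prod_(i < m) (wedge_norm (rowsub (@enum_val _ (mem (A i))) M) `^ p)%:E
      `^ alpha i.
Proof.
move=> j0 cov p0 rhoc HM; pose x n := sval (cid (HM n)).
have Mx n : row n M = hs_vec (x n) by rewrite /x; case: cid.
pose N n := normv (hs_vec (x n)); pose w n := vhat (u n) (x n).
have ME : M = (\matrix_n (N n *: w n))%R.
  by apply/row_matrixP => n; rewrite rowK Mx [LHS](hs_vecE (u n)).
have N0 n : (0 <= N n)%R by exact: sqrtr_ge0.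
have wE := wedge_norm_ratio w cov N0; rewrite /= -ME in wE.
have rho0 : (0 <= det_ratio A alpha (gram w))%R.
  rewrite /det_ratio; case: ifP => // _.
  by rewrite divr_ge0 ?sqrtr_ge0 // prodr_ge0 // => i _; exact: powR_ge0.
have prod0 : (0 <= \prod_(i < m)
    wedge_norm (rowsub (@enum_val _ (mem (A i))) M) `^ alpha i)%R.
  by apply: prodr_ge0 => i _; exact: powR_ge0.
rewrite {}wE powRM // EFinM; apply: lee_pmul; rewrite ?lee_fin ?powR_ge0 //.
  have jn0 : j%:R != 0%R :> R by rewrite pnatr_eq0 -lt0n.
  (* The bound [c] concerns the power [1/j] of the ratio, so [p] is split as [1/j] times [j * p]. *)
  have -> : (det_ratio A alpha (gram w) `^ p)%:E =
      (det_ratio A alpha (gram w) `^ j%:R^-1)%:E `^ (j%:R * p).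
    by rewrite poweR_EFin -powRrM mulrA mulVf // mul1r.
  have := rhoc x; rewrite /rho -/w => rc.
  have r0 : 0 <= (det_ratio A alpha (gram w) `^ j%:R^-1)%:E.
    by rewrite lee_fin powR_ge0.
  apply: gt0_ler_poweR => //; first by rewrite mulr_ge0 // ltW.
    by rewrite in_itv /= r0 leey.
  by rewrite in_itv /= (le_trans r0 rc) leey.
rewrite powR_prod; last by move=> i _; exact: powR_ge0.
rewrite -prodEFin; under [leRHS]eq_bigr do rewrite poweR_EFin -powRrM mulrC powRrM.
by [].
Qed.

Lemma iterated_integral_wedge_le (R : realType) d j m (A : 'I_m -> {set 'I_j})
    (alpha : 'I_m -> R) (S : 'I_j -> hypersurface R d) (u : 'I_j -> 'rV[R]_d)
    (p : R) (c : \bar R) :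
  (0 < j)%N -> uniform_cover A alpha -> (0 < p)%R ->
  (forall x : forall n, S n, (rho u A alpha x `^ j%:R^-1)%:E <= c) ->
  iterated_integral S (fun M => (wedge_norm M `^ p)%:E) <=
  c `^ (j%:R * p) * \prod_(i < m)
    iterated_integral (subfamily (A i) S) (fun M => (wedge_norm M `^ p)%:E)
      `^ alpha i.
Proof.
move=> j0 cov p0 rhoc; have [_ alpha0 cover] := cov.
pose F i (M : 'M[R]_(j, d)) :=
  (wedge_norm (rowsub (@enum_val _ (mem (A i))) M) `^ p)%:E.
have F0 i M : 0 <= F i M by rewrite lee_fin powR_ge0.
have mF i : mx_measurable (F i) by exact: mx_measurable_wedge_norm.
apply: (@le_trans _ _ (iterated_integral S
    (fun M => c `^ (j%:R * p) * \prod_(i < m) F i M `^ alpha i))).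
  apply: le_iterated_integral => M HM; apply/andP; split.
    by rewrite lee_fin powR_ge0.
  exact: (wedge_norm_powR_le j0 cov p0 rhoc HM).
rewrite iterated_integralZl ?poweR_ge0 //; last 2 first.
- move=> disp T g mg; apply: emeasurable_prod => i _.
  by apply: measurable_poweRT; exact: mF.
- by move=> M; apply: prode_ge0 => i _; exact: poweR_ge0.
apply: lee_wpmul2l; rewrite ?poweR_ge0 //.
(* Membership in [A i], in the form that [masked_integral_rowsub] produces for [enum_val]. *)
pose b i (n : 'I_j) := [exists a : 'I_#|A i|, enum_val a == n].
have bE i n : b i n = (n \in A i).
  apply/existsP/idP => [[a /eqP <-]|nA]; first exact: enum_valP.
  by exists (enum_rank_in nA n); rewrite enum_rankK_in.
have -> : \prod_(i < m) iterated_integral (subfamily (A i) S)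
      (fun M => (wedge_norm M `^ p)%:E) `^ alpha i =
    \prod_(i < m) masked_integral S (b i) (F i) `^ alpha i.
  apply: eq_bigr => i _; congr (_ `^ _); symmetry.
  exact: masked_integral_rowsub (@homo_enum_val _ (A i)).
apply: (Finner S alpha0 _ mF F0).
  move=> n; rewrite -[RHS](cover n) big_mkcond; apply: eq_bigr => i _.
  by rewrite bE; case: ifP; rewrite ?mulr1 ?mulr0.
move=> i M M' MM'; rewrite /F; congr ((wedge_norm _ `^ _)%:E).
apply/row_matrixP => a; rewrite !row_rowsub MM' // bE.
exact: enum_valP.
Qed.

(** * The inequality for [Q] and the two forms of the supremum *)

Local Open Scope ring_scope.

Theorem theorem2p1 (R : realType) (d j : nat) (hj : (1 <= j <= d)%N)
    (p : R) (hp : 0 < p) (S : 'I_j -> hypersurface R d)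
    (m : nat) (A : 'I_m -> {set 'I_j}) (alpha : 'I_m -> R)
    (hA : uniform_cover A alpha)
    (u : 'I_j -> 'rV[R]_d) (hu : forall n : 'I_j, normv (u n) = 1) :
  (Q p S <=
     ereal_sup [set (rho u A alpha x `^ j%:R^-1)%:E
               | x in [set: forall n : 'I_j, S n]]
     * \prod_(i < m)
         Q p (subfamily (A i) S) `^ (alpha i * #|A i|%:R / j%:R))%E
  /\
  ereal_sup [set (rho u A alpha x)%:E | x in [set: forall n : 'I_j, S n]] =
  ereal_sup [set (det_ratio A alpha (gram w))%:E
            | w in [set w : 'I_j -> 'rV[R]_d
                   | forall n, w n \in [set vhat (u n) y | y in [set: S n]]]].
Proof.
have [j0 _] := andP hj; have [A0 alpha0 cover] := hA.
split; last first.
  (* Both suprema run over the same set of values; in one direction a point of each [S n] is chosen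
     above the vector [w n]. *)
  congr ereal_sup; apply/seteqP; split => [_ [x _ <-]|_ [w Hw <-]].
    exists (fun n => vhat (u n) (x n)); last by [].
    move=> n.
    by rewrite inE; exists (x n).
  have {}Hw n : exists y : S n, vhat (u n) y = w n.
    by have := Hw n; rewrite inE => -[y _ yw]; exists y.
  exists (fun n => sval (cid (Hw n))); first exact: I.
  by rewrite /rho; congr ((det_ratio A alpha (gram _))%:E); apply/funext => n; case: cid.
set c := ereal_sup _; set W := fun k (M : 'M[R]_(k, d)) => (wedge_norm M `^ p)%:E.
have W0 k M : (0 <= W k M)%E by rewrite lee_fin powR_ge0.
have jp0 : 0 < j%:R :> R by rewrite ltr0n.
have card0 i : 0 < #|A i|%:R :> R by rewrite ltr0n card_gt0.
(* If some [S n] is empty, the supremum is over the empty set and equals [-oo]. Some [A i] contains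
   [n], its factor is 0, and the right-hand side is 0 because [-oo * 0 = 0]; the left-hand side is 0
   as well. *)
have [[n Sn]|Sne] := pselect (exists n, S n -> False).
  have [i nAi] : exists i, n \in A i.
    apply/not_existsP => nA; have := oner_neq0 R; rewrite -(cover n) big1 ?eqxx //.
    by move=> i _; have /negP/negbTE -> := nA i; rewrite mulr0.
  have QAi : Q p (subfamily (A i) S) = 0%E.
    rewrite /Q (@iterated_integral_empty _ _ _ _ (@W _) (enum_rank_in nAi n) _ (@W0 _)).
      by rewrite poweR0r // gt_eqF // invr_gt0 mulr_gt0.
    by rewrite /subfamily enum_rankK_in.
  have -> : (\prod_(i < m)
      Q p (subfamily (A i) S) `^ (alpha i * #|A i|%:R / j%:R) = 0)%E.
    apply: (prode_eq0 (i := i)) => //; rewrite QAi poweR0r // gt_eqF //.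
    by rewrite divr_gt0 // mulr_gt0.
  rewrite mule0 /Q (iterated_integral_empty Sn (@W0 _)).
  by rewrite poweR0r // gt_eqF // invr_gt0 mulr_gt0.
have rhoc (x : forall n, S n) : ((rho u A alpha x `^ j%:R^-1)%:E <= c)%E.
  by apply: ereal_sup_ubound; exists x.
have Sx n : exists x : S n, True.
  apply: contrapT => nx; apply: Sne; exists n => x; apply: nx; by exists x.
(* With all hypersurfaces inhabited, the supremum is at least one nonnegative value. *)
have c0 : (0 <= c)%E.
  apply: le_trans (rhoc (fun n => sval (cid (Sx n)))).
  by rewrite lee_fin powR_ge0.
have I0 i : (0 <= iterated_integral (subfamily (A i) S) (@W _))%E.
  exact: iterated_integral_ge0.
have P0 : (0 <= \prod_(i < m) iterated_integral (subfamily (A i) S) (@W _) `^ alpha i)%E.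
  by apply: prode_ge0 => i _; exact: poweR_ge0.
have le := iterated_integral_wedge_le j0 hA hp rhoc.
have {le}: (Q p S <= (c `^ (j%:R * p) * \prod_(i < m)
    iterated_integral (subfamily (A i) S) (@W _) `^ alpha i) `^ (j%:R * p)^-1)%E.
  apply: gt0_ler_poweR => //; first by rewrite invr_ge0 mulr_ge0 // ltW.
    by rewrite in_itv /= iterated_integral_ge0 ?leey // => M; exact: W0.
  by rewrite in_itv /= mule_ge0 ?poweR_ge0 // leey.
move/le_trans; apply; rewrite poweRM ?poweR_ge0 // -poweRrM.
rewrite mulfV ?poweRe1 ?mulf_neq0 ?gt_eqF //.
rewrite poweR_prod; last by move=> i _; exact: poweR_ge0.
rewrite le_eqVlt; apply/orP; left; apply/eqP; congr (_ * _)%E.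
(* With [k] the cardinal of [A i], both exponents equal [alpha i / (j * p)]: the [k] in the
   normalisation of [Q] cancels the weight [k]. *)
apply: eq_bigr => i _; rewrite /Q -!poweRrM; congr (_ `^ _)%E.
rewrite !invfM; have := lt0r_neq0 (card0 i).
by move: (#|A i|%:R : R) => k k0; rewrite mulrACA; field; rewrite k0 !gt_eqF.
Qed.
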